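(* Let $n\ge2$ and $y\in\mathbb{C}^n$. Then $y\in\widetilde{\mathbb{G}}_n$ if and only if there exist $[\frac n2]$ complex $2\times2$ matrices $B_1,\dots,B_{[\frac n2]}$ such that $\det B_1=\dots=\det B_{[\frac n2]}$, $y=\pi_n\big(B_1,\dots,B_{[\frac n2]}\big)$ and $\mu_E(B_j)<1$ for $j=1,\dots,[\frac n2]$.
   Context: $[\cdot]$ applied to a number is the integer part, and $[A]_{ik}$ is the $(i,k)$ entry of a matrix $A$. The extended symmetrized polydisc is $$\widetilde{\mathbb{G}}_n=\Big\{(y_1,\dots,y_{n-1},q)\in\mathbb{C}^n:\ |q|<1,\ \exists\,\beta_1,\dots,\beta_{n-1}\in\mathbb{C}\text{ with } y_j=\beta_j+\bar\beta_{n-j}q,\ |\beta_j|+|\beta_{n-j}|<\tbinom{n}{j},\ 1\le j\le n-1\Big\}.$$ For $2\times2$ matrices $B_1,\dots,B_k$ with $\det B_1=\dots=\det B_k$: with $n=2k+1$, $$\pi_{2k+1}(B_1,\dots,B_k)=\Big(\tbinom n1[B_1]_{11},\dots,\tbinom nk[B_k]_{11},\tbinom nk[B_k]_{22},\dots,\tbinom n1[B_1]_{22},\det B_1\Big),$$ and with $n=2k$, $$\pi_{2k}(B_1,\dots,B_k)=\Big(\tbinom n1[B_1]_{11},\dots,\tbinom n{k-1}[B_{k-1}]_{11},\tbinom nk\tfrac{[B_k]_{11}+[B_k]_{22}}2,\tbinom n{k-1}[B_{k-1}]_{22},\dots,\tbinom n1[B_1]_{22},\det B_1\Big).$$ $E=\left\{\begin{pmatrix}z&0\\0&w\end{pmatrix}:z,w\in\mathbb{C}\right\}$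 is the space of diagonal $2\times2$ matrices. For a $2\times2$ matrix $B$, the structured singular value is $$\mu_E(B)=\frac1{\inf\{\|X\|:X\in E,\ I-BX\text{ is singular}\}},$$ where $\|X\|$ is the operator norm, and $\mu_E(B)=0$ if $I-BX$ is nonsingular for all $X\in E$. *)

(* Defs.v *)
From mathcomp Require Import all_boot all_order all_algebra.
From mathcomp Require Import boolp classical_sets reals.
From mathcomp Require Import complex.

Set Implicit Arguments.
Unset Strict Implicit.
Unset Printing Implicit Defensive.

Import Order.TTheory GRing.Theory Num.Theory.
Local Open Scope classical_set_scope.
Local Open Scope complex_scope.
Local Open Scope ring_scope.

(* The j-th item of a finite family numbered from 1, as in x_1, ..., x_m;
   only meaningful for 1 <= j <= size s. *)
Definition item (V : zmodType) (s : seq V) (j : nat) : V := s`_j.-1.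

(* Moduli are taken with normc, whose values lie in R, rather than with the
   R[i]-valued norm, so that sup, inf and the order are those of R. *)
Local Notation normc := Normc.normc.

Definition l2norm (R : realType) (m : nat) (v : 'cV[R[i]]_m) : R :=
  Num.sqrt (\sum_(i < m) normc (v i 0) ^+ 2).

Definition opnorm (R : realType) (X : 'M[R[i]]_2) : R :=
  sup [set l2norm (X *m v) | v in [set v : 'cV[R[i]]_2 | l2norm v <= 1]].

Definition diagE (R : realType) : set 'M[R[i]]_2 := [set X | is_diag_mx X].

Definition singularizers (R : realType) (B : 'M[R[i]]_2) : set 'M[R[i]]_2 :=
  [set X | diagE X /\ 1%:M - B *m X \notin unitmx].

Definition mu_E (R : realType) (B : 'M[R[i]]_2) : R :=
  if `[< singularizers B !=set0 >]
  then 1 / inf [set opnorm X | X in singularizers B]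
  else 0.

(* The entry of index i : 'I_n is the coordinate numbered i.+1, so the last
   one is q. *)
Definition Gtilde (R : realType) (n : nat) : set 'rV[R[i]]_n :=
  [set y | exists (q : R[i]) (beta : (n.-1).-tuple R[i]),
    [/\ normc q < 1,
        y = \row_(i < n)
              (if i.+1 == n then q
               else item beta i.+1 + (item beta (n - i.+1))^* * q)
      & forall j : nat, (1 <= j <= n.-1)%N ->
          normc (item beta j) + normc (item beta (n - j)) < 'C(n, j)%:R]].

(* Both parities at once: the coordinates j < n/2 carry the (1,1) entry of B_j,
   the coordinates n/2 < j < n the (2,2) entry of B_(n-j), and the middle
   coordinate j = n/2, present only for n even, the mean of the diagonal. *)
Definition pi_map (R : realType) (n : nat) (B : (n./2).-tuple 'M[R[i]]_2) :
    'rV[R[i]]_n :=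
  \row_(i < n)
    let j := i.+1 in
    if j == n then \det (item B 1)
    else if (j.*2 < n)%N then 'C(n, j)%:R * item B j 0 0
    else if j.*2 == n then
      'C(n, j)%:R * ((item B j 0 0 + item B j 1 1) / 2%:R)
    else 'C(n, n - j)%:R * item B (n - j) 1 1.

(* Main.v *)
Require Import Defs.
From mathcomp Require Import all_boot all_order all_algebra.
From mathcomp Require Import boolp classical_sets reals.
From mathcomp Require Import complex.
From mathcomp Require Import ring lra zify.

Set Implicit Arguments.
Unset Strict Implicit.
Unset Printing Implicit Defensive.

Import Order.TTheory GRing.Theory Num.Theory.
Local Open Scope classical_set_scope.
Local Open Scope complex_scope.
Local Open Scope ring_scope.

(** For a diagonal [X] with entries [z, w], the determinant of [I - B X] is
    [P (z, w) = 1 - a z - d w + p z w], where [a, d] are the diagonal entries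
    of [B] and [p] its determinant; the norm of [X] is the larger of [|z|] and
    [|w|].  So [mu_E B < 1] says that the zeros of [P] stay away from the closed
    unit bidisc, a condition on [(a, d, p)] alone: membership in the tetrablock.
    The heart of the proof is the resulting parametrization [mu_E_lt1P]:
    [mu_E B < 1] iff [|p| < 1] and [a = b1 + conj b2 p], [d = b2 + conj b1 p]
    for some [b1, b2] with [|b1| + |b2| < 1].

    Given such [b1, b2], [P = zeta + p Q] with [zeta = 1 - b1 z - b2 w] and
    [Q = z w conj zeta] on the torus.  There [|Q| = |zeta|], and inside the
    bidisc [|Q| <= |zeta|] ([reflected_le]).  Hence [|P|] has a positive lower
    bound on the bidisc, and scaling a zero of [P] back to the bidisc shows that
    it lies at distance from the bidisc bounded below
    ([diag_symbol_zero_escape]).  The infimum defining [mu_E] is then [> 1].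

    Conversely, if [P] has no zero in the closed bidisc, solving [P = 0] for [z]
    gives [|a - p w| < |1 - d w|] whenever [|w| <= 1].  The worst case over
    [|w| = 1] reads [2 |d - conj a p| < 1 + |d|^2 - |a|^2 - |p|^2]; adding the
    inequality with [a] and [d] exchanged leaves
    [|a - conj d p| + |d - conj a p| < 1 - |p|^2].  Both numerators divided by
    [1 - |p|^2] are the wanted [b1] and [b2].

    The theorem follows coordinatewise: for [j < n / 2] the coordinates [j] and
    [n - j] of a point of the extended symmetrized polydisc are [binom n j]
    times the pair [(a, d)] parametrized by [beta_j] and [beta_(n-j)] divided by
    [binom n j], with [p = q].  In the middle coordinate of an even [n] the mean
    of [a] and [d] is parametrized by the mean of [b1] and [b2]. *)

Local Notation normc := Normc.normc.

(** * Modulus of a complex number *)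

Section Modulus.
Variable R : realType.
Implicit Types x y z w : R[i].

Lemma normc_ge0 x : 0 <= normc x.
Proof. by case: x => a b; rewrite /= sqrtr_ge0. Qed.

Lemma sqr_normcE x : normc x ^+ 2 = complex.Re x ^+ 2 + complex.Im x ^+ 2.
Proof. by case: x => a b /=; rewrite sqr_sqrtr // addr_ge0 // sqr_ge0. Qed.

Lemma normc_conj x : normc x^* = normc x.
Proof. by case: x => a b /=; rewrite sqrrN. Qed.

Lemma normcB x y : normc (x - y) <= normc x + normc y.
Proof. by rewrite -(normcN y) le_normcD. Qed.

Lemma normcD_ge x y : normc x - normc y <= normc (x + y).
Proof. by rewrite lerBlDr; have := normcB (x + y) y; rewrite addrK. Qed.

Lemma normc_gt0 x : (0 < normc x) = (x != 0).
Proof.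
rewrite lt_def normc_ge0 andbT; congr (~~ _).
apply/eqP/eqP => [/Normc.eq0_normc //|->]; exact: Normc.normc0.
Qed.

Lemma normc_real (a : R) : normc a%:C = `|a|.
Proof. by rewrite /= expr0n addr0 sqrtr_sqr. Qed.

Lemma normc_natr k : normc (k%:R : R[i]) = k%:R.
Proof. by rewrite -(rmorph_nat (real_complex R)) normc_real normr_nat. Qed.

Lemma Re_le_normc x : complex.Re x <= normc x.
Proof.
case: x => a b /=; apply: le_trans (ler_norm _) _.
by rewrite -sqrtr_sqr ler_wsqrtr // lerDl sqr_ge0.
Qed.

Lemma exists_rotation_onto_modulus x :
  exists w, normc w = 1 /\ complex.Re (x * w) = normc x.
Proof.
have [->|x0] := eqVneq x 0.
  by exists 1; rewrite mulr1 Normc.normc1 Normc.normc0.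
have nx : normc x != 0 by rewrite gt_eqF // normc_gt0.
exists (x^* * (normc x)^-1%:C); split.
  rewrite Normc.normcM normc_conj normc_real ger0_norm ?invr_ge0 ?normc_ge0 //.
  by rewrite divff.
apply: (mulfI nx); rewrite -expr2 sqr_normcE.
case: x x0 nx => a b _ nx /=; field.
exact: nx.
Qed.

End Modulus.

(** * Zeros of a bilinear polynomial and the bidisc *)

Section Symbol.
Variable R : realType.
Implicit Types a d p z w : R[i].

(** The determinant of [I - B X] for [X] diagonal with entries [z, w]: see
    [det_sub_mul_diag]. *)
Definition diag_symbol a d p z w := 1 - a * z - d * w + p * z * w.

Definition tetra_coord (b1 b2 p : R[i]) := b1 + b2^* * p.

(** Writing [c = 1 - b1 - b2], the difference of the two sides is
    [b1 (1 - W^2) (1 - Z)^2 + b2 (1 - Z^2) (1 - W)^2] plus [c] times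
    [1 - Z^2 W^2 - (b1 - b2) (Z^2 - W^2)].  The last factor is affine in
    [b1 - b2], which lies in [[-1, 1]], and at the endpoints it factors as
    [(1 - Z^2) (1 + W^2)] and [(1 + Z^2) (1 - W^2)]. *)
Lemma coordinate_bound (b1 b2 Z W : R) :
  0 <= b1 -> 0 <= b2 -> b1 + b2 <= 1 -> 0 <= Z <= 1 -> 0 <= W <= 1 ->
  2 * (1 - W ^+ 2) * (b1 * Z) + 2 * (1 - Z ^+ 2) * (b2 * W)
    <= 1 - Z ^+ 2 * W ^+ 2 + (b1 ^+ 2 - b2 ^+ 2) * (Z ^+ 2 - W ^+ 2).
Proof.
move=> b10 b20 b12 /andP[Z0 Z1] /andP[W0 W1].
pose c : R := 1 - b1 - b2.
have c0 : 0 <= c by rewrite /c; lra.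
have Z2 : 0 <= 1 - Z ^+ 2 by nra.
have W2 : 0 <= 1 - W ^+ 2 by nra.
rewrite -subr_ge0.
rewrite [leRHS](_ : _ = b1 * (1 - W ^+ 2) * (1 - Z) ^+ 2
  + b2 * (1 - Z ^+ 2) * (1 - W) ^+ 2
  + c * ((1 + b1 - b2) / 2 * ((1 - Z ^+ 2) * (1 + W ^+ 2))
         + (1 - b1 + b2) / 2 * ((1 + Z ^+ 2) * (1 - W ^+ 2)))); last first.
  by rewrite /c; field.
have ? : 0 <= (1 + b1 - b2) / 2 by lra.
have ? : 0 <= (1 - b1 + b2) / 2 by lra.
by do ![done | exact: sqr_ge0 | apply: addr_ge0 | apply: mulr_ge0].
Qed.

(** On the torus the left-hand polynomial is [z * w] times the conjugate of the
    right-hand one, so the moduli agree there; the inequality inside the bidisc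
    is the Schur property of their quotient, obtained by expanding the
    difference of squares: the phases enter only through the real parts of
    [b1 * z] and [b2 * w], and bounding these by the moduli leaves
    [coordinate_bound]. *)
Lemma reflected_le (b1 b2 z w : R[i]) :
  normc b1 + normc b2 <= 1 -> normc z <= 1 -> normc w <= 1 ->
  normc (z * w - b2^* * z - b1^* * w) <= normc (1 - b1 * z - b2 * w).
Proof.
move=> b12 z1 w1; rewrite -(ler_pXn2r (n := 2)) ?nnegrE ?normc_ge0 //.
have := @coordinate_bound (normc b1) (normc b2) (normc z) (normc w).
rewrite !normc_ge0 => /(_ isT isT b12 z1 w1).
have Rz : (1 - normc w ^+ 2) * complex.Re (b1 * z)
          <= (1 - normc w ^+ 2) * (normc b1 * normc z).
  rewrite -Normc.normcM ler_wpM2l ?Re_le_normc // subr_ge0.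
  by rewrite expr_le1 ?normc_ge0.
have Rw : (1 - normc z ^+ 2) * complex.Re (b2 * w)
          <= (1 - normc z ^+ 2) * (normc b2 * normc w).
  rewrite -Normc.normcM ler_wpM2l ?Re_le_normc // subr_ge0.
  by rewrite expr_le1 ?normc_ge0.
have -> : normc (z * w - b2^* * z - b1^* * w) ^+ 2 =
  normc (1 - b1 * z - b2 * w) ^+ 2 -
  (1 - normc z ^+ 2 * normc w ^+ 2
   + (normc b1 ^+ 2 - normc b2 ^+ 2) * (normc z ^+ 2 - normc w ^+ 2)
   - 2 * ((1 - normc w ^+ 2) * complex.Re (b1 * z))
   - 2 * ((1 - normc z ^+ 2) * complex.Re (b2 * w))).
  rewrite !sqr_normcE; case: b1 {b12 Rz Rw} => b1 c1; case: b2 => b2 c2.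
  by case: z {z1} => zr zi; case: w {w1} => wr wi /=; ring.
by move: Rz Rw; lra.
Qed.

Lemma diag_symbol_tetra (b1 b2 p z w : R[i]) :
  diag_symbol (tetra_coord b1 b2 p) (tetra_coord b2 b1 p) p z w =
  (1 - b1 * z - b2 * w) + p * (z * w - b2^* * z - b1^* * w).
Proof. by rewrite /diag_symbol /tetra_coord; ring. Qed.

(** The value is [zeta + p * Q] with [|Q| <= |zeta|] by [reflected_le], and
    [|zeta|] is at least [1 - |b1| - |b2|]. *)
Lemma diag_symbol_lower_bound (b1 b2 p z w : R[i]) :
  normc b1 + normc b2 <= 1 -> normc p <= 1 -> normc z <= 1 -> normc w <= 1 ->
  (1 - normc b1 - normc b2) * (1 - normc p) <=
  normc (diag_symbol (tetra_coord b1 b2 p) (tetra_coord b2 b1 p) p z w).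
Proof.
move=> b12 p1 z1 w1; rewrite diag_symbol_tetra.
have zeta_ge : 1 - normc b1 - normc b2 <= normc (1 - b1 * z - b2 * w).
  have := normcD_ge (1 - b1 * z) (- (b2 * w)).
  have := normcD_ge 1 (- (b1 * z)).
  rewrite !normcN !Normc.normcM Normc.normc1.
  have : normc b1 * normc z <= normc b1 by rewrite ler_piMr ?normc_ge0.
  have : normc b2 * normc w <= normc b2 by rewrite ler_piMr ?normc_ge0.
  lra.
have := normcD_ge (1 - b1 * z - b2 * w) (p * (z * w - b2^* * z - b1^* * w)).
apply: le_trans; rewrite Normc.normcM.
have := ler_wpM2l (normc_ge0 p) (reflected_le b12 z1 w1).
have : (1 - normc b1 - normc b2) * (1 - normc p) <=
       normc (1 - b1 * z - b2 * w) * (1 - normc p).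
  by rewrite ler_wpM2r // subr_ge0.
lra.
Qed.

(** A zero in the closed bidisc contradicts the bound.  Otherwise let [t > 1] be
    the larger modulus and [u = 1 / t].  The point [(u z, u w)] lies in the
    closed bidisc, and at a zero [(z, w)] the value there factors as
    [(1 - u) (1 - p (u z) w)], of modulus at most
    [(1 - u) (1 + t) = t - 1 / t <= 2 (t - 1)]; hence [t - 1 >= delta / 2]. *)
Lemma diag_symbol_zero_escape (a d p z w : R[i]) (delta : R) :
  0 < delta -> normc p <= 1 ->
  (forall z w, normc z <= 1 -> normc w <= 1 ->
     delta <= normc (diag_symbol a d p z w)) ->
  diag_symbol a d p z w = 0 ->
  1 + delta / 2 <= Num.max (normc z) (normc w).
Proof.
move=> delta0 p1 bound eq0; set t := Num.max _ _.
have zt : normc z <= t by rewrite le_max lexx.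
have wt : normc w <= t by rewrite le_max lexx orbT.
have [t1|t1] := leP t 1.
  have := bound z w (le_trans zt t1) (le_trans wt t1).
  by rewrite eq0 Normc.normc0; lra.
have t0 : 0 < t by lra.
pose u := (t^-1)%:C.
have nu : normc u = t^-1 by rewrite normc_real gtr0_norm ?invr_gt0.
have in_disc x : normc x <= t -> normc (u * x) <= 1.
  by move=> xt; rewrite Normc.normcM nu mulrC ler_pdivrMr // mul1r.
have := bound (u * z) (u * w) (in_disc _ zt) (in_disc _ wt).
have -> : diag_symbol a d p (u * z) (u * w) =
    (1 - u) * (1 - p * (u * z) * w) + u * diag_symbol a d p z w.
  by rewrite /diag_symbol; ring.
rewrite eq0 mulr0 addr0 Normc.normcM.
have -> : normc (1 - u) = 1 - t^-1.
  rewrite -(rmorph1 (real_complex R)) -rmorphB normc_real ger0_norm //.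
  by rewrite subr_ge0 invf_le1 // ltW.
have : normc (1 - p * (u * z) * w) <= 1 + t.
  apply: le_trans (normcB _ _) _; rewrite Normc.normc1 lerD2l.
  rewrite 2!Normc.normcM -[leRHS]mul1r ler_pM ?mulr_ge0 ?normc_ge0 //.
  by rewrite -[leRHS]mul1r ler_pM ?normc_ge0 ?in_disc.
move=> le1 le2.
have u1 : 0 <= 1 - t^-1 by rewrite subr_ge0 invf_le1 // ltW.
have := le_trans le2 (ler_wpM2l u1 le1).
have -> : (1 - t^-1) * (1 + t) = t - t^-1 by field; lra.
have : t^-1 = 1 - (t - 1) * t^-1 by field; lra.
have : (t - 1) * t^-1 <= t - 1.
  by rewrite ler_piMr ?invf_le1 // ?ltW // subr_gt0.
lra.
Qed.

(** For fixed [w] the equation [diag_symbol a d p z w = 0] is affine in [z],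
    with solution [(1 - d w) / (a - p w)], which must fall outside the disc. *)
Lemma zero_free_ratio (a d p w : R[i]) :
  (forall z w, normc z <= 1 -> normc w <= 1 -> diag_symbol a d p z w != 0) ->
  normc w <= 1 -> normc (a - p * w) < normc (1 - d * w).
Proof.
move=> zfree w1; rewrite ltNge; apply/negP => le.
have [num0|num0] := eqVneq (a - p * w) 0.
  move: le; rewrite num0 Normc.normc0 leNgt normc_gt0 => /negP; apply.
  have -> : 1 - d * w = diag_symbol a d p 0 w by rewrite /diag_symbol; ring.
  by rewrite zfree ?Normc.normc0.
have z1 : normc ((1 - d * w) / (a - p * w)) <= 1.
  by rewrite Normc.normcM Normc.normcV ler_pdivrMr ?normc_gt0 // mul1r.
have /eqP[] := zfree _ _ z1 w1.
by rewrite /diag_symbol; field.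
Qed.

(** [zero_free_ratio] squared, at the unimodular [w] which turns
    [(d - a^* * p) * w] into its modulus. *)
Lemma zero_free_half (a d p : R[i]) :
  (forall z w, normc z <= 1 -> normc w <= 1 -> diag_symbol a d p z w != 0) ->
  2 * normc (d - a^* * p) <
  1 + normc d ^+ 2 - normc a ^+ 2 - normc p ^+ 2.
Proof.
move=> zfree.
have [w [w1 <-]] := exists_rotation_onto_modulus (d - a^* * p).
have : normc (a - p * w) ^+ 2 < normc (1 - d * w) ^+ 2.
  rewrite ltr_pXn2r ?nnegrE ?normc_ge0 //.
  by apply: (zero_free_ratio zfree); rewrite w1.
have : normc w ^+ 2 = 1 by rewrite w1 expr1n.
(* In coordinates, the factors |w|^2 are isolated before being set to 1. *)
rewrite !sqr_normcE; case: a {zfree} => a a'; case: d => d d'; case: p => p p'.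
case: w {w1} => w w' /= nw.
have -> : (a - (p * w - p' * w')) ^+ 2 + (a' - (p * w' + p' * w)) ^+ 2 =
  (a ^+ 2 + a' ^+ 2) + (p ^+ 2 + p' ^+ 2) * (w ^+ 2 + w' ^+ 2)
   - 2 * (a * (p * w - p' * w') + a' * (p * w' + p' * w)) by ring.
have -> : (1 - (d * w - d' * w')) ^+ 2 + (0 - (d * w' + d' * w)) ^+ 2 =
  1 + (d ^+ 2 + d' ^+ 2) * (w ^+ 2 + w' ^+ 2) - 2 * (d * w - d' * w') by ring.
by rewrite nw; lra.
Qed.

(** The equations for [b1, b2] are real-linear, with the unique solution
    [b1 = (a - d^* * p) / (1 - |p|^2)] and [b2 = (d - a^* * p) / (1 - |p|^2)].
    The sum of [zero_free_half] for [(a, d)] and for [(d, a)] says that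
    [|b1| + |b2| < 1], and also forces [|p| < 1]. *)
Lemma zero_free_tetra (a d p : R[i]) :
  (forall z w, normc z <= 1 -> normc w <= 1 -> diag_symbol a d p z w != 0) ->
  exists b1 b2, [/\ normc p < 1, normc b1 + normc b2 < 1,
    a = tetra_coord b1 b2 p & d = tetra_coord b2 b1 p].
Proof.
move=> zfree.
have zfree' z w : normc z <= 1 -> normc w <= 1 -> diag_symbol d a p z w != 0.
  move=> z1 w1; have := zfree w z w1 z1; congr (_ != _).
  by rewrite /diag_symbol; ring.
have H1 := zero_free_half zfree; have H2 := zero_free_half zfree'.
have sum_lt : normc (a - d^* * p) + normc (d - a^* * p) < 1 - normc p ^+ 2.
  by lra.
have D0 : 0 < 1 - normc p ^+ 2.
  by apply: le_lt_trans sum_lt; rewrite addr_ge0 ?normc_ge0.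
have p1 : normc p < 1.
  by rewrite -(expr_lt1 (n := 2)) ?normc_ge0 // -subr_gt0.
pose D := 1 - p * p^*.
have DE : D = (1 - normc p ^+ 2)%:C.
  rewrite sqr_normcE /D; case: (p) => r s /=.
  by apply/eqP; rewrite eq_complex /=; apply/andP; split; apply/eqP; ring.
have nD : normc D = 1 - normc p ^+ 2 by rewrite DE normc_real gtr0_norm.
have D0' : D != 0 by rewrite -normc_gt0 nD.
have DJ : D^* = D by rewrite /D rmorphB rmorph1 rmorphM /= conjCK mulrC.
exists ((a - d^* * p) / D), ((d - a^* * p) / D); split => //.
- rewrite !Normc.normcM !Normc.normcV nD -mulrDl ltr_pdivrMr // mul1r //.
- rewrite /tetra_coord rmorphM rmorphB rmorphM fmorphV /= conjCK DJ /D.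
  field; exact: D0'.
- rewrite /tetra_coord rmorphM rmorphB rmorphM fmorphV /= conjCK DJ /D.
  field; exact: D0'.
Qed.

End Symbol.

(** * The structured singular value of a 2 x 2 matrix *)

Section StructuredSingularValue.
Variable R : realType.
Implicit Types (B X : 'M[R[i]]_2) (v : 'cV[R[i]]_2).

Lemma l2norm_sqr v : l2norm v ^+ 2 = normc (v 0 0) ^+ 2 + normc (v 1 0) ^+ 2.
Proof.
rewrite sqr_sqrtr; last by apply: sumr_ge0 => i _; apply: sqr_ge0.
rewrite big_ord_recl big_ord1; congr (_ + normc (v _ _) ^+ 2).
exact: val_inj.
Qed.

Lemma l2norm_ge0 v : 0 <= l2norm v.
Proof. exact: sqrtr_ge0. Qed.

Lemma l2norm_leP v (c : R) : 0 <= c ->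
  (l2norm v <= c) = (normc (v 0 0) ^+ 2 + normc (v 1 0) ^+ 2 <= c ^+ 2).
Proof.
by move=> c0; rewrite -l2norm_sqr ler_pXn2r // nnegrE ?l2norm_ge0.
Qed.

Lemma diag_mulmxE X v i : is_diag_mx X -> (X *m v) i 0 = X i i * v i 0.
Proof.
move=> /is_diag_mxP dX; rewrite mxE (bigD1 i) //= big1 ?addr0 // => j ji.
by rewrite dX ?mul0r // eq_sym.
Qed.

(** The unit vectors of the standard basis attain the two moduli. *)
Lemma opnorm_diag X : is_diag_mx X ->
  opnorm X = Num.max (normc (X 0 0)) (normc (X 1 1)).
Proof.
move=> dX; set t := Num.max _ _.
have t0 : 0 <= t by rewrite le_max normc_ge0.
pose S := [set l2norm (X *m v) | v in [set v | l2norm v <= 1]].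
have ubS : ubound S t.
  move=> _ [v /= v1 <-]; rewrite l2norm_leP // !diag_mulmxE // !Normc.normcM.
  move: v1; rewrite l2norm_leP // expr1n => v1.
  have sq (x : R[i]) : normc x <= t -> normc x ^+ 2 <= t ^+ 2.
    by move=> xt; rewrite ler_pXn2r ?nnegrE ?normc_ge0.
  have q0 : normc (X 0 0) ^+ 2 <= t ^+ 2 by rewrite sq // le_max lexx.
  have q1 : normc (X 1 1) ^+ 2 <= t ^+ 2 by rewrite sq // le_max lexx orbT.
  rewrite !exprMn.
  have := ler_wpM2r (sqr_ge0 (normc (v 0 0))) q0.
  have := ler_wpM2r (sqr_ge0 (normc (v 1 0))) q1.
  have := ler_wpM2l (sqr_ge0 t) v1.
  lra.
have inS (k : 'I_2) : normc (X k k) <= opnorm X.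
  have Sk : S (l2norm (X *m delta_mx k 0)).
    exists (delta_mx k 0) => //=; rewrite l2norm_leP // !mxE.
    by case: k => [[|[|//]]] kP; rewrite /=
      ?(expr1n, expr0n, addr0, add0r, sqrtr0, sqrtr1).
  have hub : has_ubound S by exists t.
  apply: le_trans (ub_le_sup hub Sk).
  rewrite -(ler_pXn2r (n := 2)) ?nnegrE ?normc_ge0 ?l2norm_ge0 // l2norm_sqr.
  rewrite !diag_mulmxE // !mxE.
  case: k Sk => [[|[|//]]] kP _.
    have -> : Ordinal kP = 0 by apply: val_inj.
    by rewrite !eqxx mulr1 lerDl sqr_ge0.
  have -> : Ordinal kP = 1 by apply: val_inj.
  by rewrite !eqxx mulr1 lerDr sqr_ge0.
apply/eqP; rewrite eq_le ge_max !inS !andbT.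
apply: ge_sup => //; exists (l2norm (X *m 0)), 0 => //=.
by rewrite l2norm_leP // !mxE Normc.normc0 expr0n addr0 expr1n ler01.
Qed.

Lemma det_mx2 B : \det B = B 0 0 * B 1 1 - B 0 1 * B 1 0.
Proof.
rewrite (expand_det_row _ 0) !big_ord_recl big_ord0 addr0 /cofactor !det_mx11.
rewrite !mxE.
have -> : lift 0 0 = 1 :> 'I_2 by apply: val_inj.
have -> : lift 1 0 = 0 :> 'I_2 by apply: val_inj.
by rewrite expr0 expr1 mul1r mulN1r mulrN.
Qed.

Lemma det_sub_mul_diag B X : is_diag_mx X ->
  \det (1%:M - B *m X) =
  diag_symbol (B 0 0) (B 1 1) (\det B) (X 0 0) (X 1 1).
Proof.
move=> /is_diag_mxP dX.
have X01 : X 0 1 = 0 by apply: dX.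
have X10 : X 1 0 = 0 by apply: dX.
have e1 : lift ord0 ord0 = 1 :> 'I_2 by apply: val_inj.
rewrite !det_mx2 !mxE !big_ord_recl !big_ord0 !e1 X01 X10 /diag_symbol /=.
by ring.
Qed.

Lemma singularizersE B :
  singularizers B =
  [set X | is_diag_mx X /\
     diag_symbol (B 0 0) (B 1 1) (\det B) (X 0 0) (X 1 1) = 0].
Proof.
apply/seteqP; split=> X [dX]; rewrite ?unitmxE ?unitfE ?det_sub_mul_diag //.
  by move=> /negPn/eqP.
move=> eq0; split=> //; rewrite unitmxE unitfE det_sub_mul_diag //.
by rewrite negbK; apply/eqP.
Qed.

(** Zeros also stay away from the origin.  This is what makes the infimum in
    [mu_E] positive, so that its inverse is the true inverse and not the
    conventional [0^-1 = 0]. *)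
Lemma diag_symbol_zero_large (a d p z w : R[i]) :
  diag_symbol a d p z w = 0 -> normc z <= 1 -> normc w <= 1 ->
  (1 + normc a + normc d + normc p)^-1 <= Num.max (normc z) (normc w).
Proof.
move=> eq0 z1 w1; set t := Num.max _ _.
have zt : normc z <= t by rewrite le_max lexx.
have wt : normc w <= t by rewrite le_max lexx orbT.
have ? := normc_ge0 a; have ? := normc_ge0 d; have ? := normc_ge0 p.
have t0 : 0 <= t by rewrite le_max normc_ge0.
rewrite -div1r ler_pdivrMr; last by lra.
have : 1 = a * z + d * w - p * z * w.
  by apply: subr0_eq; rewrite -[RHS]eq0 /diag_symbol; ring.
move=> eq1.
have tri : 1 <= normc a * normc z + normc d * normc w
                + normc p * normc z * normc w.
  rewrite -[leLHS](@Normc.normc1 R) {1}eq1 -!Normc.normcM.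
  by apply: le_trans (normcB _ _) _; rewrite lerD2r le_normcD.
have ha := ler_wpM2l (normc_ge0 a) zt.
have hd := ler_wpM2l (normc_ge0 d) wt.
have hp : normc p * normc z * normc w <= normc p * t.
  rewrite -mulrA ler_wpM2l ?normc_ge0 //.
  by rewrite -[t]mulr1 ler_pM ?normc_ge0.
lra.
Qed.

(** A zero in the closed bidisc brings the infimum down to [1] or less, while
    [diag_symbol_zero_large] keeps it positive, so [mu_E B >= 1].  Hence
    [mu_E B < 1] gives a zero-free bidisc and [zero_free_tetra] applies.
    Conversely [diag_symbol_zero_escape] puts the infimum above [1]. *)
Lemma mu_E_lt1P B :
  mu_E B < 1 <->
  exists b1 b2, [/\ normc (\det B) < 1, normc b1 + normc b2 < 1,
    B 0 0 = tetra_coord b1 b2 (\det B) & B 1 1 = tetra_coord b2 b1 (\det B)].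
Proof.
rewrite /mu_E; set S := [set opnorm X | X in singularizers B].
have inS z w : diag_symbol (B 0 0) (B 1 1) (\det B) z w = 0 ->
    S (Num.max (normc z) (normc w)).
  move=> eq0; pose u : 'rV[R[i]]_2 := \row_i (if i == 0 then z else w).
  have du := diag_mx_is_diag u.
  exists (diag_mx u); first by rewrite singularizersE; split=> //; rewrite !mxE.
  by rewrite opnorm_diag // !mxE.
have S_lb : has_lbound S.
  by exists 0 => _ [X [dX _] <-]; rewrite opnorm_diag // le_max normc_ge0.
split=> [mu1|[b1 [b2 [p1 b12 eq_a eq_d]]]].
  apply: zero_free_tetra => z w z1 w1; apply/eqP => eq0.
  have Szw := inS _ _ eq0.
  have ne : singularizers B !=set0 by case: Szw => X SX _; exists X.
  move: mu1; rewrite asboolT // -/S ltNge => /negP; apply.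
  pose m := 1 + normc (B 0 0) + normc (B 1 1) + normc (\det B).
  have m1 : 1 <= m by rewrite /m -!addrA lerDl !addr_ge0 ?normc_ge0.
  have m0 : 0 < m by apply: lt_le_trans m1.
  have c0 : 0 < m^-1 by rewrite invr_gt0.
  have c1 : m^-1 <= 1 by rewrite invf_le1.
  have inf_gt0 : 0 < inf S.
    apply: lt_le_trans c0 _; apply: lb_le_inf.
      by exists (Num.max (normc z) (normc w)).
    move=> r [X]; rewrite singularizersE => -[dX X0] <-; rewrite opnorm_diag //.
    have [X1|X1] := leP (Num.max (normc (X 0 0)) (normc (X 1 1))) 1.
      by move: X1; rewrite ge_max => /andP[]; exact: diag_symbol_zero_large.
    by apply: le_trans c1 (ltW X1).
  rewrite ler_pdivlMr // mul1r; apply: le_trans (ge_inf S_lb Szw) _.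
  by rewrite ge_max z1.
case: asboolP => [[X0 SX0]|_]; last exact: ltr01.
set delta := (1 - normc b1 - normc b2) * (1 - normc (\det B)).
have delta0 : 0 < delta by apply: mulr_gt0; lra.
have : 1 + delta / 2 <= inf S.
  apply: lb_le_inf; first by exists (opnorm X0), X0.
  move=> r [X]; rewrite singularizersE => -[dX eq0] <-; rewrite opnorm_diag //.
  apply: diag_symbol_zero_escape eq0 => //; first exact: ltW.
  move=> z w z1 w1; rewrite eq_a eq_d.
  by apply: diag_symbol_lower_bound => //; apply: ltW.
move=> inf_gt1; rewrite ltr_pdivrMr; lra.
Qed.

End StructuredSingularValue.

(** * Points of the extended symmetrized polydisc as images of matrices *)

Lemma item_mktuple (V : zmodType) (m : nat) (F : nat -> V) (j : nat) :
  (1 <= j <= m)%N -> item [tuple F i.+1 | i < m] j = F j.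
Proof.
case: j => // j /= jm; rewrite /item /=.
by rewrite (nth_map (Ordinal jm)) ?size_enum_ord // nth_enum_ord.
Qed.

Lemma tnth_item (V : zmodType) (m : nat) (s : m.-tuple V) (i : 'I_m) :
  tnth s i = item s i.+1.
Proof. by rewrite (tnth_nth 0). Qed.

Section Correspondence.
Variables (R : realType) (n : nat).
Hypothesis n2 : (2 <= n)%N.
Implicit Type B : (n./2).-tuple 'M[R[i]]_2.

(** A matrix with prescribed diagonal and determinant; the lower left entry [1]
    leaves the upper right one to adjust the determinant. *)
Definition tetra_matrix (b1 b2 q : R[i]) : 'M[R[i]]_2 :=
  let a := tetra_coord b1 b2 q in let d := tetra_coord b2 b1 q in
  \matrix_(i, j) if i == 0 then if j == 0 then a else a * d - q
                 else if j == 0 then 1 else d.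

Lemma tetra_matrixE (b1 b2 q : R[i]) :
  [/\ tetra_matrix b1 b2 q 0 0 = tetra_coord b1 b2 q,
      tetra_matrix b1 b2 q 1 1 = tetra_coord b2 b1 q
    & \det (tetra_matrix b1 b2 q) = q].
Proof.
rewrite det_mx2 !mxE; split=> //=; ring.
Qed.

Lemma scaled_tetra_coord (c : nat) (b1 b2 q : R[i]) :
  c%:R * tetra_coord b1 b2 q = c%:R * b1 + (c%:R * b2)^* * q.
Proof. by rewrite /tetra_coord rmorphM rmorph_nat; ring. Qed.

Lemma binR_neq0 j : (j <= n)%N -> 'C(n, j)%:R != 0 :> R[i].
Proof. by move=> jn; rewrite pnatr_eq0 -lt0n bin_gt0. Qed.

(** For [n] even and [j = n / 2] both parameters of the [j]-th matrix coincide,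
    so its diagonal entries are equal to their mean. *)
Lemma Gtilde_mu_E (y : 'rV[R[i]]_n) : Gtilde y ->
  exists B, [/\ forall i j : 'I_(n./2), \det (tnth B i) = \det (tnth B j),
    y = pi_map B & forall j : 'I_(n./2), mu_E (tnth B j) < 1].
Proof.
move=> [q [beta [q1 -> beta_lt]]].
pose b j := item beta j / 'C(n, j)%:R.
pose M j := tetra_matrix (b j) (b (n - j)%N) q.
pose B := [tuple M i.+1 | i < n./2].
have BM j : (1 <= j <= n./2)%N -> item B j = M j by exact: item_mktuple.
have tM (i : 'I_(n./2)) : tnth B i = M i.+1 by rewrite tnth_mktuple.
have detM j : \det (M j) = q by have [] := tetra_matrixE (b j) (b (n - j)%N) q.
have M00 j : M j 0 0 = tetra_coord (b j) (b (n - j)%N) q.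
  by have [] := tetra_matrixE (b j) (b (n - j)%N) q.
have M11 j : M j 1 1 = tetra_coord (b (n - j)%N) (b j) q.
  by have [] := tetra_matrixE (b j) (b (n - j)%N) q.
have Cb j : (j <= n)%N -> 'C(n, j)%:R * b j = item beta j.
  by move=> jn; rewrite /b mulrC divfK // binR_neq0.
have Cb' j : (j <= n)%N -> 'C(n, j)%:R * b (n - j)%N = item beta (n - j).
  by move=> jn; rewrite -bin_sub // Cb // leq_subr.
exists B; split.
- by move=> i j; rewrite !tM !detM.
- apply/rowP=> i; rewrite !mxE /=; set j := i.+1.
  have jn : (j <= n)%N by exact: ltn_ord.
  case: eqVneq => [_|j_n]; first by rewrite BM ?detM //; lia.
  have [j2|j2] := ltnP j.*2 n.
    by rewrite BM; [rewrite M00 scaled_tetra_coord Cb ?Cb' | lia].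
  case: eqVneq => [jj|j2'].
    rewrite BM; last by lia.
    rewrite M00 M11; have -> : (n - j)%N = j by lia.
    by rewrite mulrDl -splitr scaled_tetra_coord Cb.
  rewrite BM; last by lia.
  by rewrite M11 bin_sub // subKn // scaled_tetra_coord Cb ?Cb'.
move=> i; rewrite tM; have := ltn_ord i; move: i.+1 (ltn0Sn i) => j j0 jn.
apply/mu_E_lt1P; exists (b j), (b (n - j)%N); rewrite detM M00 M11.
split=> //; have C0 : 0 < 'C(n, j)%:R :> R by rewrite ltr0n bin_gt0; lia.
rewrite -(ltr_pM2l C0) mulrDr mulr1.
rewrite -(normc_natr R 'C(n, j)) -!Normc.normcM Cb ?Cb' ?normc_natr; try lia.
by apply: beta_lt; lia.
Qed.

(** For [n] even, averaging the two parametrizations of the diagonal entries of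
    the last matrix parametrizes their mean, by [(b1 + b2) / 2] alone; its
    modulus is below [1 / 2], as the condition at [j = n / 2] requires. *)
Lemma mu_E_Gtilde B :
  (forall i j : 'I_(n./2), \det (tnth B i) = \det (tnth B j)) ->
  (forall j : 'I_(n./2), mu_E (tnth B j) < 1) -> Gtilde (pi_map B).
Proof.
move=> detB muB; pose q := \det (item B 1).
have paramB (j : nat) : exists b : R[i] * R[i], (1 <= j <= n./2)%N ->
  [/\ normc q < 1, normc b.1 + normc b.2 < 1,
      item B j 0 0 = tetra_coord b.1 b.2 q
    & item B j 1 1 = tetra_coord b.2 b.1 q].
  have [jm|] := boolP (1 <= j <= n./2)%N; last by exists (0, 0).
  have m0 : (0 < n./2)%N by lia.
  have jlt : (j.-1 < n./2)%N by lia.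
  have qE : \det (item B j) = q.
    have := detB (Ordinal jlt) (Ordinal m0); rewrite !tnth_item /=.
    by rewrite prednK //; lia.
  have := muB (Ordinal jlt); rewrite tnth_item /= prednK; last by lia.
  by move=> /mu_E_lt1P [b1 [b2]]; rewrite qE => ?; exists (b1, b2).
have [b bP] := choice paramB.
pose g j : R[i] := 'C(n, j)%:R *
  (if (j.*2 < n)%N then (b j).1
   else if j.*2 == n then ((b j).1 + (b j).2) / 2
   else (b (n - j)%N).2).
pose beta := [tuple g i.+1 | i < n.-1].
have betaE j : (1 <= j <= n.-1)%N -> item beta j = g j by exact: item_mktuple.
have q1 : normc q < 1 by have [] := bP 1%N; lia.
have gL j : (j.*2 < n)%N -> g j = 'C(n, j)%:R * (b j).1.
  by rewrite /g => ->.
have gR j : (j.*2 < n)%N -> g (n - j)%N = 'C(n, j)%:R * (b j).2.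
  move=> j2; rewrite /g bin_sub ?subKn; try lia.
  by rewrite ltnNge (_ : (n <= _)%N) 1?(_ : (_ == n) = false) //; lia.
have gM j : j.*2 = n -> g j = 'C(n, j)%:R * (((b j).1 + (b j).2) / 2).
  by move=> j2; rewrite /g j2 ltnn eqxx.
exists q, beta; split=> //.
  apply/rowP=> i; rewrite !mxE /=; set j := i.+1.
  have jn : (j <= n)%N by exact: ltn_ord.
  case: eqVneq => // j_n; rewrite !betaE; try lia.
  have [j2|j2] := ltnP j.*2 n.
    have [_ _ -> _] := bP j ltac:(lia).
    by rewrite scaled_tetra_coord gL ?gR.
  case: eqVneq => [jj|j2'].
    have [_ _ -> ->] := bP j ltac:(lia).
    have -> : (n - j)%N = j by lia.
    rewrite gM // -scaled_tetra_coord /tetra_coord; congr (_ * _).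
    by rewrite rmorphM rmorphD fmorphV rmorph_nat; field.
  have [_ _ _ ->] := bP (n - j)%N ltac:(lia).
  have j2n : ((n - j).*2 < n)%N by lia.
  by rewrite scaled_tetra_coord -(gL _ j2n) -(gR _ j2n) subKn.
have lt_bin j : (1 <= j)%N -> (j.*2 < n)%N ->
    normc (g j) + normc (g (n - j)%N) < 'C(n, j)%:R.
  move=> j1 j2; have [_ b_lt _ _] := bP j ltac:(lia).
  rewrite gL ?gR // !Normc.normcM normc_natr -mulrDr.
  by rewrite gtr_pMr // ltr0n bin_gt0; lia.
move=> j jn; rewrite !betaE; try lia.
have [j2|j2] := ltnP j.*2 n; first by apply: lt_bin; lia.
have [jj|j2'] := eqVneq j.*2 n; last first.
  rewrite addrC -bin_sub; last by lia.
  have := lt_bin (n - j)%N; rewrite subKn; last by lia.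
  by apply; lia.
have -> : (n - j)%N = j by lia.
have [_ b_lt _ _] := bP j ltac:(lia).
rewrite gM // !Normc.normcM Normc.normcV !normc_natr -mulrDr.
rewrite gtr_pMr; last by rewrite ltr0n bin_gt0; lia.
have := le_normcD (b j).1 (b j).2; lra.
Qed.

End Correspondence.

Theorem theorem3p1 (R : realType) (n : nat) (hn : (2 <= n)%N)
    (y : 'rV[R[i]]_n) :
  Gtilde y <->
  exists B : (n./2).-tuple 'M[R[i]]_2,
    [/\ forall i j : 'I_(n./2), \det (tnth B i) = \det (tnth B j),
        y = pi_map B
      & forall j : 'I_(n./2), mu_E (tnth B j) < 1].
Proof.
split; first exact: Gtilde_mu_E.
by move=> [B [detB -> muB]]; exact: mu_E_Gtilde.
Qed.
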